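(* $t_2(n,2)=(1+o(1))\,n\log_2 n$ as $n\to\infty$.
   Context: All graphs are finite, simple and undirected. An $r$-colouring of a graph $G$ is a function $c:E(G)\to\{1,\dots,r\}$ (not necessarily proper). A path is rainbow if all its edges have distinct colours. Paths connecting two vertices are called disjoint if they are internally vertex-disjoint. For a $2$-connected graph $G$, a colouring is rainbow $2$-connected if every two vertices of $G$ are connected by two internally vertex-disjoint rainbow paths, and the rainbow $2$-connection number $rc_2(G)$ is the minimum number of colours in a rainbow $2$-connected colouring of $G$. For integers $n$ and $r\ge 1$, $t_2(n,r)$ denotes the minimum number of edges in a $2$-connected graph $G$ on $n$ vertices with $rc_2(G)\le r$. *)

(* Defs.v *)
From mathcomp Require Import all_boot all_order all_algebra.
From mathcomp Require Import all_classical all_reals all_analysis.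

Set Implicit Arguments.
Unset Strict Implicit.
Unset Printing Implicit Defensive.

Import Order.TTheory GRing.Theory Num.Theory.

(* The least element of [P]; the value is a dummy 0 when [P] is empty. *)
Definition least (P : set nat) : nat :=
  xget 0 [set m | P m /\ forall k, P k -> m <= k]%classic.

Record sgraph (V : finType) := SGraph {
  adj :> rel V;
  adj_sym : symmetric adj;
  adj_irr : irreflexive adj }.

Definition edges (V : finType) (G : sgraph V) : {set {set V}} :=
  [set e : {set V} | [exists x, exists y, G x y && (e == [set x; y])]].

(* Connectedness of the subgraph induced by [A]. *)
Definition connected_on (V : finType) (G : sgraph V) (A : {set V}) : Prop :=
  {in A &, forall x y,
    connect [rel u v | [&& u \in A, v \in A & G u v]] x y}.

(* [k]-connected: more than [k] vertices, and deleting fewer than [k] vertices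
   never disconnects the graph. *)
Definition k_connected (k : nat) (V : finType) (G : sgraph V) : Prop :=
  k < #|V| /\ forall X : {set V}, #|X| < k -> connected_on G (~: X).

(* A path from [x] to [y] is given by the sequence [p] of its vertices
   after [x]. *)
Definition is_path (V : finType) (G : sgraph V) (x y : V) (p : seq V) : bool :=
  [&& path G x p, last x p == y & uniq (x :: p)].

Definition path_edges (V : finType) (x : V) (p : seq V) : seq {set V} :=
  pairmap (fun u v => [set u; v]) x p.

Definition path_interior (V : finType) (x : V) (p : seq V) : seq V :=
  behead (belast x p).

(* Only the values of [c] on the edges of [G] are relevant; the colours
   {1, ..., r} are represented by 0, ..., r - 1. *)
Definition is_colouring (V : finType) (G : sgraph V) (r : nat)
    (c : {set V} -> nat) : Prop :=
  {in edges G, forall e, c e < r}.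

Definition rainbow (V : finType) (c : {set V} -> nat) (x : V) (p : seq V) :
    bool :=
  uniq [seq c e | e <- path_edges x p].

(* [p1 != p2] prevents a single edge [xy], whose interior is empty, from being
   counted as two paths. *)
Definition rainbow_2connected (V : finType) (G : sgraph V)
    (c : {set V} -> nat) : Prop :=
  forall x y : V, x != y -> exists p1 p2 : seq V,
    [/\ is_path G x y p1 && rainbow c x p1,
        is_path G x y p2 && rainbow c x p2,
        p1 != p2
      & ~~ has (mem (path_interior x p1)) (path_interior x p2)].

(* By Menger's theorem the minimum exists for every 2-connected [G], the only
   case in which [rc2] is used. *)
Definition rc2 (V : finType) (G : sgraph V) : nat :=
  least [set r | exists c, is_colouring G r c /\ rainbow_2connected G c]%classic.

Definition t2 (n r : nat) : nat :=
  least [set m | exists G : sgraph 'I_n,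
    [/\ k_connected 2 G, rc2 G <= r & #|edges G| = m]]%classic.

Definition log2 (R : realType) (x : R) : R := (ln x / ln 2)%R.

(* Main.v *)
Require Import Defs.
From mathcomp Require Import all_boot all_order all_algebra.
From mathcomp Require Import all_classical all_reals all_analysis.
From mathcomp Require Import zify lra.
Import Order.TTheory GRing.Theory Num.Theory.
Import numFieldNormedType.Exports.

(* With two colours, rainbow paths have at most two edges, so for every vertex
   [z] the red and the blue neighbours of [z] span a complete bipartite graph,
   and these bicliques cover all pairs of vertices.

   Lower bound: let [H] be the set of vertices of degree at least
   [D = polylog n]; it has [o(n)] elements.  For each [z] in [H] discard at
   random the red or the blue neighbours of [z] (Hansel's argument).  The
   survivors outside [H] are pairwise linked through vertices of degree less
   than [D], so there are at most [D^2 + 1] of them.  As a vertex with [d]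
   neighbours in [H] survives with probability [2^-d], almost all vertices have
   [(1 - o(1)) log n] neighbours in [H].

   Upper bound: join a clique [Z] on about [log n] vertices completely to all
   other vertices, and give each outer vertex [v] its own nonempty subset [g v]
   of [Z] of even size; [vz] has colour 1 iff [z \in g v], and the edges inside
   [Z] have colour 0.  By parity, distinct outer vertices are separated by two
   elements of [Z]. *)

Set Implicit Arguments.
Unset Strict Implicit.

(** Any known member of [P] excludes the dummy case, so upper bounds on [least] come from exhibiting
    members. *)
Lemma leastP (P : set nat) m : P m -> P (least P) /\ least P <= m.
Proof.
move=> Pm; have exP : exists k, `[< P k >] by exists m; exact/asboolP.
have [k /asboolP Pk kmin] := ex_minnP exP.
have : least P \in [set j | P j /\ forall i, P i -> j <= i]%classic.
  apply/mem_set; apply: (@xgetPex _ 0 [set j | P j /\ forall i, P i -> j <= i]%classic).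
  by exists k; split=> // i Pi; apply/kmin/asboolP.
by rewrite inE => -[? minP]; split=> //; exact: minP.
Qed.

(** * Menger's theorem for two paths in a 2-connected graph *)

Section Menger.
Variables (V : finType) (G : sgraph V).

(* [q1] and [q2] are the interiors of the paths. *)
Definition two_paths (x y : V) (q1 q2 : seq V) :=
  [/\ path G x (rcons q1 y) && uniq (x :: rcons q1 y),
      path G x (rcons q2 y) && uniq (x :: rcons q2 y),
      q1 != q2 & ~~ has (mem q1) q2].

Lemma two_pathsC x y q1 q2 : two_paths x y q1 q2 -> two_paths x y q2 q1.
Proof. by case=> ? ? ? ?; split=> //; rewrite 1?eq_sym 1?has_sym. Qed.

Lemma avoiding_path (x y w : V) : k_connected 2 G ->
  x != y -> x != w -> y != w ->
  exists q, [/\ path G x (rcons q y), uniq (x :: rcons q y) & w \notin q].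
Proof.
move=> [_ conn] xy xw yw.
have := conn [set w]; rewrite cards1 => /(_ isT x y).
rewrite !inE xw yw => /(_ isT isT) /connectP[p0 p0P ly].
case/shortenP: p0P ly => p; case/lastP: p => [|q z] pP up _ /=.
  by move=> yx; rewrite yx eqxx in xy.
rewrite last_rcons => yz; rewrite -{z}yz in pP up.
exists q; split=> //.
  by apply: sub_path pP => u v /and3P[].
apply/negP => wq.
have : all (fun u => u != w) (rcons q y).
  elim: (rcons q y) (x) pP => //= u s IH v /andP[/and3P[_ + _] /IH ->].
  by rewrite !inE => ->.
by move/allP/(_ w); rewrite mem_rcons inE wq orbT eqxx => /(_ isT).
Qed.

Lemma third_vertex (x y : V) : 2 < #|V| -> exists w, w != x /\ w != y.
Proof.
move=> V3; have : 0 < #|~: [set x; y]|.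
  by rewrite cardsCs finset.setCK subn_gt0 (leq_ltn_trans _ V3) // cards2; case: (x != y).
by case/card_gt0P=> w; rewrite !inE negb_or => /andP[? ?]; exists w.
Qed.

(** One path is the edge [xy]. The other leaves [x] by a neighbour [w] other than [y], the first
    vertex of a path avoiding [y], and continues from [w] to [y] avoiding [x]. *)
Lemma two_paths_adj (x y : V) : k_connected 2 G -> G x y ->
  exists q1 q2, two_paths x y q1 q2.
Proof.
move=> G2 xy; have xNy : x != y by apply: contraTneq xy => ->; rewrite adj_irr.
have [u [ux uy]] := third_vertex x y (proj1 G2).
have [] := @avoiding_path x u y G2; rewrite // 1?eq_sym //.

move=> q [pq _ yq]; pose w := head u q.
have [xw wNy] : G x w /\ w != y.
  split; first by move: pq; rewrite headI => /andP[].
  by rewrite /w; case: (q) yq => //= a s; rewrite inE eq_sym => /norP[].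
have wNx : w != x by apply: contraTneq xw => ->; rewrite adj_irr.
have [] := @avoiding_path w y x G2; rewrite // 1?eq_sym //.
move=> r [pr ur xr]; exists [::], (w :: r); split=> //=.
- by rewrite xy inE xNy.
- rewrite xw pr -rcons_cons mem_rcons !inE negb_or xNy negb_or eq_sym wNx xr; exact: ur.
- by apply/hasPn.
Qed.

(** Serves to find where a detour leaves a given set of vertices for the last time. *)
Lemma split_last (T : Type) (P : pred T) x s : P x ->
  exists s1 z s2, [/\ x :: s = rcons s1 z ++ s2, P z & ~~ has P s2].
Proof.
elim: s x => [|y s IH] x Px; first by exists [::], x, [::].
have [hP|nP] := boolP (has P (y :: s)); last by exists [::], x, (y :: s).
elim/last_ind: s {IH} hP => [|s z IH] hP.
  by exists [:: x], y, [::]; move: hP; rewrite has_seq1.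
have [Pz|Pz] := boolP (P z); first by exists (x :: y :: s), z, [::]; rewrite cats0.
have [|s1 [t [s2 [e Pt ns]]]] := IH; first by move: hP; rewrite /= has_rcons (negPf Pz).
by exists s1, t, (rcons s2 z); rewrite -rcons_cat -e has_rcons (negPf Pz).
Qed.

(* The detour [r] from [x] to [y] leaves the union of the two paths to [w] at
   a last vertex: [x] or a vertex [z] of, say, [q1].  Following [q1] up to [z]
   and then [r] gives one path to [y]; the other one is [q2] and the edge [wy]. *)
Lemma two_paths_step (x w y : V) q1 q2 : k_connected 2 G -> G w y -> y != x ->
  w != x -> two_paths x w q1 q2 -> exists q1 q2, two_paths x y q1 q2.
Proof.
move=> G2 wy yx wx tp.
have wNy : w != y by apply: contraTneq wy => ->; rewrite adj_irr.
(* If [y] already lies on [p1], cut [p1] there; the other path follows [p2] to [w] and takes the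
   edge [wy]. *)
have inq p1 p2 : y \in p1 -> two_paths x w p1 p2 ->
    exists q1 q2, two_paths x y q1 q2.
  case/splitPr => a b [/andP[pp1 up1] /andP[pp2 up2] _ dis].
  have wa : w \notin a.
    by move: up1; rewrite -rcons_cons rcons_uniq inE mem_cat => /andP[/norP[_ /norP[]]].
  exists a, (rcons p2 w); split.
  - move: pp1 up1; rewrite rcons_cat rcons_cons -cat_rcons cat_path => /andP[-> _].
    by rewrite -cat_cons cat_uniq => /andP[].
  - rewrite rcons_path pp2 last_rcons wy -rcons_cons rcons_uniq up2 andbT /=.
    rewrite !(mem_rcons, inE) (negPf yx) eq_sym (negPf wNy) /=.
    rewrite andbT; apply: contraNN dis => yp2.
    by apply/hasP; exists y => //=; rewrite mem_cat mem_head orbT.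
  - by apply: contraNneq wa => ->; rewrite mem_rcons mem_head.
  - rewrite has_rcons negb_or wa.
    by apply: contraNN dis => /hasP[u u2 /= ua]; apply/hasP; exists u => //=; rewrite mem_cat ua.
have [yq1|yq1] := boolP (y \in q1); first exact: inq yq1 tp.
have [yq2|yq2] := boolP (y \in q2); first exact: inq yq2 (two_pathsC tp).
have [] := @avoiding_path x y w G2; rewrite 1?eq_sym // 1?eq_sym //.
move=> r [pr ur wr].
pose onq := [pred u | [|| u == x, u \in q1 | u \in q2]].
have [|s1 [z [s2 [e Pz ns]]]] := @split_last _ onq x r; first by rewrite /= eqxx.
have [pz uz wz] : [/\ path G z (rcons s2 y), uniq (z :: rcons s2 y) & w \notin s2].
  case: s1 e => [[<- <-]|x' s1 [_ e]]; first by [].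
  move: pr ur wr; rewrite e mem_cat negb_or rcons_cat cat_path last_rcons.
  move=> /andP[_ ->] + /andP[_ ->].
  by rewrite cat_rcons -cat_cons cat_uniq => /andP[_ /andP[_ ->]].
have ys2 : y \notin s2 by move: uz; rewrite /= rcons_uniq => /and3P[].
have {}Pz : z = x \/ exists p1 p2,
    [/\ z \in p1, two_paths x w p1 p2, y \notin p1, y \notin p2
      & ~~ has (mem (x :: p1 ++ p2)) s2].
  case/or3P: Pz => [/eqP->|zq|zq]; [by left|right..].
    exists q1, q2; split=> //; apply: contraNN ns => /hasP[u us].
    by rewrite /= inE mem_cat => uP; apply/hasP; exists u.
  exists q2, q1; split=> //; first exact: two_pathsC.
  apply: contraNN ns => /hasP[u us].
  by rewrite /= inE mem_cat [(u \in q2) || _]orbC => uP; apply/hasP; exists u.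
have ext p : path G x (rcons p w) && uniq (x :: rcons p w) -> y \notin p ->
    path G x (rcons (rcons p w) y) && uniq (x :: rcons (rcons p w) y).
  move=> /andP[pp up] yp; rewrite rcons_path pp last_rcons wy -rcons_cons rcons_uniq up.
  by rewrite inE mem_rcons inE (negPf yx) eq_sym (negPf wNy) (negPf yp).
case: Pz => [zx|[p1 [p2 []]]].
  case: tp => _ tp _ _; exists s2, (rcons q2 w); split.
  - by rewrite -zx pz.
  - exact: ext.
  - by apply: contraNneq wz => ->; rewrite mem_rcons mem_head.
  - rewrite has_rcons negb_or wz; apply: contraNN ns => /hasP[u uq /= us].
    by apply/hasP; exists u => //=; rewrite uq !orbT.
case/splitPr=> a b [/andP[pp1 up1] tp2 _ dis] yp1 yp2 {}ns.
have wa : w \notin a ++ z :: b.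
  by move: up1; rewrite -rcons_cons rcons_uniq inE => /andP[/norP[]].
exists (a ++ z :: s2), (rcons p2 w); split.
- rewrite rcons_cat cat_path /= pz andbT.
  move: pp1; rewrite rcons_cat cat_path /= => /andP[-> /andP[-> _]] /=.
  rewrite -[_ && _]/(uniq ((x :: a) ++ z :: rcons s2 y)) cat_uniq uz andbT.
  move: up1; rewrite rcons_cat -cat_cons cat_uniq => /and3P[-> /= + _].
  rewrite negb_or => /andP[za _]; rewrite negb_or za /=.
  apply/hasPn => u; rewrite mem_rcons inE => /orP[/eqP->|us] /=.
    rewrite inE (negPf yx)/=; apply: contraNN yp1; by rewrite mem_cat => ->.
  apply: contraNN ns => ua; apply/hasP; exists u => //=.
  by move: ua; rewrite !(inE, mem_cat) => /orP[]->; rewrite ?orbT.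
- exact: ext.
- apply: contraNneq wa => /(congr1 (fun s => w \in s)).
  by rewrite mem_rcons mem_head !mem_cat !inE (negPf wz) orbF => /orP[]->; rewrite ?orbT.
- rewrite has_rcons negb_or; apply/andP; split.
    apply: contraNN wa; rewrite /= !mem_cat !inE (negPf wz) orbF.
    by case/orP=> ->; rewrite ?orbT.
  apply/hasPn => u up2; rewrite /= mem_cat inE.
  apply/negP => /or3P[ua|uz'|us].
  + by case/negP: dis; apply/hasP; exists u => //=; rewrite mem_cat ua.
  + by case/negP: dis; apply/hasP; exists u => //=; rewrite mem_cat inE uz' orbT.
  + by case/negP: ns; apply/hasP; exists u => //=; rewrite !(inE, mem_cat) up2 !orbT.
Qed.

(** Induction along a walk from [x] to [y]. The case [lx] covers its first edge and any later return
    to [x]. *)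
Lemma two_pathsP (x y : V) : k_connected 2 G -> x != y ->
  exists q1 q2, two_paths x y q1 q2.
Proof.
move=> G2 xy; have := proj2 G2 finset.set0; rewrite cards0 => /(_ isT x y).
rewrite !inE => /(_ isT isT) /connectP[p pp yp]; rewrite {y}yp in xy *.
have {}pp : path G x p by apply: sub_path pp => u v /and3P[].
elim/last_ind: p pp xy => [|p y IH]; first by rewrite /= eqxx.
rewrite rcons_path last_rcons => /andP[pp ly] xy.
have [lx|lx] := eqVneq (last x p) x; first by apply: two_paths_adj; rewrite // -lx.
have [|q1 [q2 tp]] := IH pp; first by rewrite eq_sym.
by apply: two_paths_step G2 ly _ lx tp; rewrite eq_sym.
Qed.

(** The first edge contains [x], and none of the later ones does. *)
Lemma uniq_path_edges (x : V) p : uniq (x :: p) -> uniq (path_edges x p).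
Proof.
elim: p x => //= y p IH x /andP[xp up]; rewrite IH //= andbT.
have sub : forall e, e \in path_edges y p -> e \subset y :: p.
  elim: p y {IH xp up} => //= z p IH y e; rewrite inE => /orP[/eqP->|/IH sp].
    by apply/fintype.subsetP => u; rewrite !inE orbA => ->.
  by apply: fintype.subset_trans sp _; apply/fintype.subsetP => u; rewrite !inE => ->; rewrite orbT.
by apply: contraNN xp => /sub/fintype.subsetP/(_ x); rewrite !inE eqxx => /(_ isT).
Qed.

(* Excludes the dummy value 0 of [rc2] at an empty set of colourings. *)
Lemma rc2_attained : k_connected 2 G ->
  exists c, is_colouring G (rc2 G) c /\ rainbow_2connected G c.
Proof.
(* When every set has a colour of its own, all paths are rainbow. *)
move=> G2; pose c (e : {set V}) : nat := enum_rank e.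
pose P := [set r | exists c, is_colouring G r c /\ rainbow_2connected G c]%classic.
suff : P #|{set V}| by case/leastP.
exists c; split=> [e _|x y xy]; first exact: ltn_ord.
have [q1 [q2 [/andP[p1 u1] /andP[p2 u2] q12 dis]]] := two_pathsP G2 xy.
have rb p : uniq (x :: p) -> rainbow c x p.
  move=> /uniq_path_edges up; rewrite /rainbow map_inj_uniq //.
  by move=> e f /ord_inj/enum_rank_inj.
exists (rcons q1 y), (rcons q2 y); split.
- by rewrite /is_path p1 last_rcons eqxx u1 rb.
- by rewrite /is_path p2 last_rcons eqxx u2 rb.
- by apply: contraNneq q12 => /rcons_inj[->].
- by rewrite /path_interior !belast_rcons.
Qed.

End Menger.

(** * Rainbow paths with two colours *)

Lemma set2_edges (V : finType) (G : sgraph V) (x y : V) :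
  G x y -> [set x; y] \in edges G.
Proof.
move=> xy; rewrite inE; apply/existsP; exists x.
by apply/existsP; exists y; rewrite xy /=.
Qed.

Definition two_coloured_links (V : finType) (G : sgraph V) (col : V -> V -> bool) :=
  forall x y, x != y -> exists z, [/\ G x z, G y z & col x z != col y z].

(** Among three edges two share a colour, so a rainbow path has at most two. The two distinct paths
    are not both the edge [xy], hence one of them passes through a single vertex [z]. *)
Lemma rainbow_links (V : finType) (G : sgraph V) c :
  is_colouring G 2 c -> rainbow_2connected G c ->
  two_coloured_links G (fun v z => c [set v; z] == 0).
Proof.
move=> c2 rb x y xy.
have short p : is_path G x y p && rainbow c x p -> p = [:: y] \/
    exists z, [/\ G x z, G y z & (c [set x; z] == 0) != (c [set y; z] == 0)].
  rewrite /is_path /rainbow => /andP[/and3P[]].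
  case: p => [|a [|b [|d p]]] /=; first by rewrite (negPf xy).
  - by move=> _ /eqP->; left.
  - move=> /and3P[xa ab _] /eqP by_ _; subst y; rewrite inE andbT => nc; right; exists a.
    rewrite adj_sym in ab; split=> //; rewrite (finset.setUC [set a]) in nc.
    move: (c2 _ (set2_edges xa)) (c2 _ (set2_edges ab)) nc.
    by case: (c _) => [|[|?]] //; case: (c _) => [|[|?]].
  move=> /and4P[/set2_edges/c2 + /set2_edges/c2 + /set2_edges/c2 + _] _ _.
  rewrite !inE.
  by do 3!case: (c _) => [|[|?]] //; rewrite /= ?andbF.
have [p1 [p2 [/short[e1|//] /short[e2|//]]]] := rb x y xy.
by rewrite e1 e2 eqxx.
Qed.

(** * Lower bound by Hansel's argument *)

Section LowerBound.
Variables (V : finType) (G : sgraph V) (col : V -> V -> bool) (D k : nat).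
Hypothesis links : two_coloured_links G col.

Let nb v := [set z | G v z].
Let H := [set v | D <= #|nb v|].
Let hnb v := nb v :&: H.

Lemma handshake : \sum_v #|nb v| <= 2 * #|edges G|.
Proof.
have le v : #|nb v| <= \sum_(e in edges G) (v \in e).
  rewrite -big_mkcondr sum1_card -(card_in_imset (f := fun z => [set v; z])).
    apply: subset_leq_card; apply/fintype.subsetP => _ /imsetP[z + ->].
    by rewrite [z \in _]inE => /set2_edges vz; rewrite unfold_in /= vz !inE eqxx.
  move=> z t; rewrite !inE => vz vt /setP/(_ z); rewrite !inE eqxx orbT.
  by case: eqP vz => [->|_ _]; [rewrite adj_irr|move/esym/eqP].
apply: (@leq_trans (\sum_v \sum_(e in edges G) (v \in e))).
  by apply: leq_sum => v _.
rewrite exchange_big /=.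
rewrite mulnC -sum_nat_const; apply: leq_sum => e; rewrite inE.
case/existsP=> x /existsP[y /andP[_ /eqP->]].
by rewrite -big_mkcond sum1_card cards2; case: eqP.
Qed.

Lemma high_degree_card : #|H| * D <= 2 * #|edges G|.
Proof.
apply: leq_trans handshake; rewrite -sum_nat_const [leqRHS](bigID (mem H)) /=.
by apply: leq_trans (leq_addr _ _); apply: leq_sum => v; rewrite inE.
Qed.

(** An edge from [v] outside [H] into [H] meets the complement of [H] in [v] alone, so it is counted
    for no other vertex. *)
Lemma cross_edges : \sum_(v in ~: H) #|hnb v| <= #|edges G|.
Proof.
have le v : v \in ~: H -> #|hnb v| <= \sum_(e in edges G) (e :&: ~: H == [set v]).
  move=> vH; rewrite -big_mkcondr sum1_card -(card_in_imset (f := fun z => [set v; z])).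
    apply: subset_leq_card; apply/fintype.subsetP => _ /imsetP[z + ->].
    rewrite [z \in _]inE [z \in nb _]inE => /andP[/set2_edges vz zH]; rewrite unfold_in /= vz /=.
    apply/eqP/setP => u; rewrite finset.in_setI in_set2 finset.in_set1 finset.in_setC.
    case: eqP => [->|_] /=; first by rewrite -finset.in_setC vH.
    by case: eqP => [->|_] //=; rewrite zH.
  move=> z t; rewrite !inE => /andP[vz _] _ /setP/(_ z); rewrite !inE eqxx orbT.
  by case: eqP vz => [->|_ _]; [rewrite adj_irr|move/esym/eqP].
apply: (@leq_trans (\sum_(v in ~: H) \sum_(e in edges G) (e :&: ~: H == [set v]))).
  by apply: leq_sum.
rewrite exchange_big /=.
rewrite -sum1_card; apply: leq_sum => e _.
rewrite -big_mkcondr sum1_card; apply/card_le1_eqP => u v.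
by rewrite !unfold_in /= => /andP[_ /eqP->] /andP[_ /eqP/set1_inj->].
Qed.

(* Each vertex of [H] keeps one of its two colour classes; [v] survives if it
   lies in none of the discarded ones. *)
Let survives (f : {ffun V -> bool}) v := [forall z in hnb v, col v z == f z].

(** The choice is forced at the vertices of [hnb v] and free at all others. *)
Lemma card_survives v : #|[set f | survives f v]| = 2 ^ (#|V| - #|hnb v|).
Proof.
pose F z := [pred b | (z \in hnb v) ==> (col v z == b)].
have -> : #|[set f | survives f v]| = #|family F|.
  rewrite cardsE; apply: eq_card => f; rewrite !inE.
  by apply: eq_forallb => z.
rewrite card_family foldrE big_image /=.
rewrite (eq_bigr (fun z => if z \in hnb v then 1 else 2)); last first.
  move=> z _; rewrite /F; case: (z \in hnb v) => /=.
    by rewrite (eq_card (B := pred1 (col v z))) ?card1 // => b; rewrite !inE eq_sym.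
  by rewrite (eq_card (B := predT)) // card_bool.
rewrite (bigID (mem (hnb v))) /= big1 ?mul1n => [|z ->//].
rewrite (eq_bigr (fun=> 2)); last by move=> z /=; case: (z \in hnb v).
rewrite prod_nat_const; congr (_ ^ _).
by rewrite -(cardsC (hnb v)) addKn; apply: eq_card => z; rewrite finset.in_setC.
Qed.

(* Two survivors are linked through a vertex outside [H], hence lie within
   distance two of each other through vertices of degree less than [D]. *)
Lemma survivors_card f : #|[set v in ~: H | survives f v]| <= D * D + 1.
Proof.
have [->|[x]] := set_0Vmem [set v in ~: H | survives f v]; first by rewrite cards0.
rewrite inE => /andP[xH /forall_inP sx].
have le : [set v in ~: H | survives f v] \subset
    \bigcup_(z in nb x :\: H) nb z :|: [set x].
  apply/fintype.subsetP => y; rewrite inE => /andP[yH /forall_inP sy].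
  rewrite inE finset.in_set1; case: (eqVneq x y) => [->|xy]; first by rewrite orbT.
  have [z [xz yz cz]] := links xy.
  apply/orP; left; apply/bigcupP; exists z; last by rewrite inE adj_sym.
  (* If [z] were in [H], survival of [x] and [y] would give both edges at [z] the colour [f z]. *)
  rewrite inE [z \in nb _]inE xz andbT; apply: contraNN cz => zH.
  have hz u : G u z -> z \in hnb u by move=> uz; rewrite inE [z \in nb _]inE uz zH.
  by rewrite (eqP (sx z (hz x xz))) (eqP (sy z (hz y yz))).
apply: leq_trans (subset_leq_card le) _.
apply: leq_trans (leq_card_setU _ _) _; rewrite cards1 leq_add2r.
apply: (@leq_trans (\sum_(z in nb x :\: H) D)).
  apply: (big_ind2 (fun (A : {set V}) m => #|A| <= m)) => [|A a B b Aa Bb|z].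
  - by rewrite cards0.
  - exact: leq_trans (leq_card_setU _ _) (leq_add Aa Bb).
  - by rewrite !inE -ltnNge => /andP[/ltnW].
rewrite sum_nat_const leq_mul2r (leq_trans (subset_leq_card (subsetDl _ _))) ?orbT //.
by move: xH; rewrite !inE -ltnNge => /ltnW.
Qed.

(** Double counting of pairs of a choice [f] and a survivor [v]: each [v] counted here survives at
    least [2 ^ (#|V| - k)] choices, and each choice has at most [D * D + 1] survivors. *)
Lemma few_low_vertices :
  #|[set v in ~: H | #|hnb v| < k]| <= 2 ^ k * (D * D + 1).
Proof.
set B := [set v in _ | _].
have n2 : 0 < 2 ^ (#|V| - k) by rewrite expn_gt0.
rewrite -(leq_pmul2r n2).
apply: (@leq_trans (\sum_(v in ~: H) 2 ^ (#|V| - #|hnb v|))).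
  rewrite [leqRHS](bigID (mem B)) /= -sum_nat_const.
  rewrite [X in _ <= X + _](eq_bigl (mem B)); last first.
    by move=> v; rewrite /= !inE; case: (D <= _).
  apply: leq_trans (leq_addr _ _); apply: leq_sum => v; rewrite inE => /andP[_ vk].
  by rewrite leq_exp2l // leq_sub2l // ltnW.
apply: (@leq_trans (2 ^ #|V| * (D * D + 1))).
  under eq_bigr do rewrite -card_survives -sum1_card big_mkcond /=.
  rewrite exchange_big /=.
  have -> : 2 ^ #|V| = #|{ffun V -> bool}| by rewrite card_ffun card_bool.
  rewrite -sum_nat_const; apply: leq_sum => f _; apply: leq_trans (survivors_card f).
  rewrite -sum1_card -big_mkcondr /=; apply: eq_leq; apply: eq_bigl => v.
  by rewrite !inE.
(* Only an inequality of exponents, since [#|V| - k] is truncated at 0. *)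
rewrite mulnAC leq_mul2r -expnD leq_exp2l // orbC.
by rewrite -leq_subLR leqnn.
Qed.

(** Here [h] is the size of [H]. Outside [H], all but the few low vertices have at least [k]
    neighbours in [H], and [cross_edges] counts these edges once. *)
Lemma edges_lower_bound : exists h, h * D <= 2 * #|edges G| /\
  k * (#|V| - h - 2 ^ k * (D * D + 1)) <= #|edges G|.
Proof.
exists #|H|; split; first exact: high_degree_card.
apply: leq_trans cross_edges.
set B := [set v in ~: H | #|hnb v| < k].
apply: (@leq_trans (k * #|~: H :\: B|)).
  rewrite leq_mul2l; apply/orP; right; rewrite cardsD [#|~: H|]cardsCs finset.setCK.
  apply: leq_sub2l; apply: leq_trans few_low_vertices.
  by apply: subset_leq_card; apply: subsetIr.
rewrite mulnC -sum_nat_const [leqRHS](bigID (fun v => v \in ~: H :\: B)) /=.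
apply: leq_trans (leq_addr _ _).
rewrite [leqRHS](eq_bigl (mem (~: H :\: B))); last first.
  by move=> v; rewrite /= !inE; case: (D <= _); rewrite ?andbF.
by apply: leq_sum => v; rewrite !inE => /andP[+ vH]; rewrite vH /= -leqNgt.
Qed.
End LowerBound.

(** * Upper bound: a graph built from an even-weight code *)

Section Construction.
Variables (V : finType) (Z : {set V}) (g : V -> {set V}).
Hypothesis V3 : 2 < #|V|.
Hypothesis Z2 : 1 < #|Z|.
Hypothesis gZ : forall v, v \notin Z ->
  [/\ g v \subset Z, g v != finset.set0 & ~~ odd #|g v|].
Hypothesis g_inj : {in ~: Z &, injective g}.
(** Gives two elements of the clique a rainbow path through an outer vertex, besides the edge
    joining them. *)
Hypothesis g_sep : forall z t, z \in Z -> t \in Z -> z != t ->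
  exists2 v, v \notin Z & (z \in g v) != (t \in g v).

Let cadj x y := (x != y) && ((x \in Z) || (y \in Z)).

Let cadj_sym : symmetric cadj.
Proof. by move=> x y; rewrite /cadj eq_sym orbC. Qed.

Let cadj_irr : irreflexive cadj.
Proof. by move=> x; rewrite /cadj eqxx. Qed.

Definition code_graph := SGraph cadj_sym cadj_irr.

(** A colour depends on an unordered pair, so the outer end of an edge is recovered as its element
    outside [Z]; edges inside [Z] have none and get 0. *)
Definition code_colour (e : {set V}) : nat :=
  [exists v in e :\: Z, [exists z in e, z \in g v]].

Lemma code_colour_cross v z : v \notin Z -> z \in Z ->
  code_colour [set v; z] = (z \in g v).
Proof.
move=> vZ zZ; rewrite /code_colour; congr (nat_of_bool _).
apply/exists_inP/idP => [[u]|zv]; last first.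
  exists v; first by rewrite !inE vZ eqxx.
  by apply/exists_inP; exists z; rewrite ?inE ?eqxx ?orbT.
rewrite !inE => /andP[uZ /orP[/eqP->|/eqP uz]]; last by rewrite uz zZ in uZ.
case/exists_inP => w; rewrite !inE => /orP[/eqP->|/eqP->//].
by have [/fintype.subsetP/(_ v) sub _ _] := gZ vZ; move/sub; rewrite (negPf vZ).
Qed.

Lemma code_colour_in z t : z \in Z -> t \in Z -> code_colour [set z; t] = 0.
Proof.
move=> zZ tZ; rewrite /code_colour; case: exists_inP => // -[u].
by rewrite !inE => /andP[uZ /orP[]/eqP uE]; rewrite uE ?zZ ?tZ in uZ.
Qed.

(** The symmetric difference [S] of [g v] and [g w] is nonempty by injectivity and even by parity,
    so it has two elements. *)
Lemma two_links v w : v \notin Z -> w \notin Z -> v != w ->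
  exists z t, [/\ z \in Z, t \in Z, z != t,
    (z \in g v) != (z \in g w) & (t \in g v) != (t \in g w)].
Proof.
move=> vZ wZ vw; pose S := (g v :\: g w) :|: (g w :\: g v).
have [vsub _ vodd] := gZ vZ; have [wsub _ wodd] := gZ wZ.
have Sne : S != finset.set0.
  apply: contra_neq vw => /eqP; rewrite finset.setU_eq0 !finset.setD_eq0 => /andP[s1 s2].
  by apply: g_inj; rewrite ?inE //; apply/eqP; rewrite finset.eqEsubset s1.
have Sodd : ~~ odd #|S|.
  have -> : #|S| = #|g v :\: g w| + #|g w :\: g v|.
    apply/eqP; rewrite (leq_card_setU _ _).2 -finset.setI_eq0; apply/eqP/setP => u.
    by rewrite !inE; case: (u \in g v); rewrite ?andbF.
  move: vodd wodd; rewrite -(cardsID (g w) (g v)) -(cardsID (g v) (g w)).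
  by rewrite finset.setIC !oddD; do 3 case: (odd _).
have : 1 < #|S| by move: Sne Sodd; rewrite -card_gt0; case: #|S| => [|[]].
case/card_gt1P=> z [t [zS tS zt]]; exists z, t.
have P u : u \in S -> u \in Z /\ (u \in g v) != (u \in g w).
  rewrite !inE => /orP[]/andP[/negPf-> u1]; rewrite u1; split=> //.
    exact: (fintype.subsetP vsub).
  exact: (fintype.subsetP wsub).
by have [? ?] := P z zS; have [? ?] := P t tS.
Qed.

(** Two outer vertices are joined through two elements of [Z] by [two_links]. Otherwise the edge
    [xy] is one path; the other passes through a separating outer vertex if both ends are in [Z],
    and else through an element of the code set of the outer end that differs from the end in [Z],
    with colours 0 and 1. *)
Lemma code_rainbow : rainbow_2connected code_graph code_colour.
Proof.
have p1 x y : cadj x y ->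
    is_path code_graph x y [:: y] && rainbow code_colour x [:: y].
  by move=> xy; rewrite /is_path /rainbow /= xy eqxx inE (andP xy).1.
have p2 x z y : x != y -> cadj x z -> cadj z y ->
    code_colour [set x; z] != code_colour [set z; y] ->
    is_path code_graph x y [:: z; y] && rainbow code_colour x [:: z; y].
  move=> nxy xz zy cxy; rewrite /is_path /rainbow /= xz zy eqxx !inE cxy.
  by rewrite negb_or nxy (andP xz).1 (andP zy).1.
have two v : v \notin Z -> forall z, exists2 w, w \in g v & w != z.
  move=> /gZ[_ ne ev] z; have : 1 < #|g v|.
    by move: ne ev; rewrite -card_gt0; case: #|g v| => [|[]].
  case/card_gt1P=> w [t [wv tv wt]]; have [wz|wz] := eqVneq w z; last by exists w.
  by exists t; rewrite // -wz eq_sym.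
have sub v w : v \notin Z -> w \in g v -> w \in Z.
  by move=> /gZ[/fintype.subsetP + _ _]; apply.
have short v y : [:: y] != [:: v; y] by rewrite eqseq_cons andbF.
have adjl v z : v \notin Z -> z \in Z -> cadj v z.
  by move=> vZ zZ; rewrite /cadj zZ orbT andbT; apply: contraNneq vZ => ->.
have adjr v z : v \notin Z -> z \in Z -> cadj z v by rewrite cadj_sym; exact: adjl.
move=> x y xy; have [xZ|xZ] := boolP (x \in Z); have [yZ|yZ] := boolP (y \in Z).
- have [v vZ sep] := g_sep xZ yZ xy; exists [:: y], [:: v; y]; split=> //.
    by apply: p1; rewrite /cadj xy xZ.
  apply: p2 => //; [exact: adjr|exact: adjl|].
  by rewrite finset.setUC !code_colour_cross //; move: sep; do 2 case: (_ \in _).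
- have [w wy wx] := two y yZ x; have wZ := sub y w yZ wy.
  exists [:: y], [:: w; y]; split=> //; first by apply: p1; rewrite /cadj xy xZ.
  apply: p2 => //; [by rewrite /cadj eq_sym wx xZ|exact: adjr|].
  by rewrite code_colour_in // finset.setUC code_colour_cross // wy.
- have [w wx wy] := two x xZ y; have wZ := sub x w xZ wx.
  exists [:: y], [:: w; y]; split=> //; first by apply: p1; rewrite /cadj xy yZ orbT.
  apply: p2 => //; [exact: adjl|by rewrite /cadj wZ wy|].
  by rewrite code_colour_cross // code_colour_in // wx.
- have [z [t [zZ tZ zt zxy txy]]] := two_links xZ yZ xy.
  have p3 u : u \in Z -> (u \in g x) != (u \in g y) ->
      is_path code_graph x y [:: u; y] && rainbow code_colour x [:: u; y].
    move=> uZ uxy; apply: p2 => //; [exact: adjl|exact: adjr|].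
    by rewrite (finset.setUC [set u]) !code_colour_cross //; move: uxy; do 2 case: (_ \in _).
  exists [:: z; y], [:: t; y]; split; [exact: p3|exact: p3| |].
    by apply: contraNneq zt => -[->].
  by rewrite /path_interior /= !inE orbF eq_sym.
Qed.

Lemma code_graph_rc2 : rc2 code_graph <= 2.
Proof.
pose P := [set r | exists c, is_colouring code_graph r c /\
                             rainbow_2connected code_graph c]%classic.
suff : P 2 by case/leastP.
by exists code_colour; split=> [e _|]; [rewrite ltnS leq_b1|exact: code_rainbow].
Qed.

(** Some [w] in [Z] escapes the deletion, and [w] is adjacent to every other vertex. *)
Lemma code_graph_2connected : k_connected 2 code_graph.
Proof.
split=> // X X2 x y; rewrite !inE => xX yX.
have /subsetPn[w wZ wX] : ~~ (Z \subset X).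
  by apply: contraTN X2 => /subset_leq_card; rewrite -leqNgt; exact: leq_trans.
apply: (@connect_trans _ _ w).
  have [->|xw] := eqVneq x w; first exact: connect0.
  by apply: connect1; rewrite /= !inE xX wX /cadj xw wZ orbT.
have [->|yw] := eqVneq y w; first exact: connect0.
by apply: connect1; rewrite /= !inE yX wX /cadj eq_sym yw wZ.
Qed.

Lemma code_graph_edges : #|edges code_graph| <= #|V| * #|Z|.
Proof.
rewrite -cardsT -cardsX.
apply: leq_trans (leq_imset_card (fun p : V * V => [set p.1; p.2]) _).
apply: subset_leq_card; apply/fintype.subsetP => e; rewrite inE.
case/existsP=> x /existsP[y /andP[/andP[_ /orP[zZ|zZ]] /eqP->]].
  by apply/imsetP; exists (y, x); rewrite ?inE //= finset.setUC.
by apply/imsetP; exists (x, y); rewrite ?inE.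
Qed.
End Construction.

(** The outer vertices get distinct nonempty subsets of a [b]-set [Z0], of which there are
    [2 ^ b - 1]. As [b.*2 < #|V|], there are at least [b] outer vertices, enough to use every
    singleton. *)
Lemma sparse_graph (V : finType) (b : nat) : 1 < b ->
  b.*2 < #|V| -> #|V| - b.+1 < 2 ^ b ->
  exists G : sgraph V, [/\ k_connected 2 G, rc2 G <= 2 & #|edges G| <= #|V| * b.+1].
Proof.
move=> b1 bV Vb.
have [Z0 cZ0] : exists Z0 : {set V}, #|Z0| = b.
  exists [set x in take b (enum V)]; rewrite cardsE.
  have /card_uniqP-> : uniq (take b (enum V)) by rewrite take_uniq ?enum_uniq.
  rewrite size_take_min -cardE; apply/minn_idPl; rewrite ltnW //.
  by rewrite (leq_trans _ bV) // ltnS -addnn leq_addr.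
have [zp zpZ0] : exists zp, zp \notin Z0.
  have : 0 < #|~: Z0| by rewrite cardsCs finset.setCK cZ0; lia.
  by case/card_gt0P=> zp; rewrite inE; exists zp.
pose Z := zp |: Z0.
have cZ : #|Z| = b.+1 by rewrite cardsU1 zpZ0 cZ0.
pose ones : {set {set V}} := (fun z : V => [set z]) @: Z0.
pose P : {set {set V}} := powerset Z0 :\ finset.set0.
(* Singletons come first, so that all of them are assigned. *)
pose s : seq {set V} := enum ones ++ enum (P :\: ones).
have onesP : ones \subset P.
  apply/fintype.subsetP => _ /imsetP[z zZ0 ->].
  rewrite !inE -cards_eq0 cards1; apply/fintype.subsetP => u.
  by rewrite inE => /eqP->.
have size_ones : size (enum ones) = b by rewrite -cardE card_imset //; exact: set1_inj.
have size_s : size s = 2 ^ b - 1.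
  rewrite size_cat -!cardE -{1}(finset.setIidPr onesP) cardsID.
  have := cardsD1 finset.set0 (powerset Z0).
  by rewrite card_powerset cZ0 inE finset.sub0set => ->; rewrite addKn.
have uniq_s : uniq s.
  rewrite cat_uniq !enum_uniq andbT /=; apply/hasPn => A.
  by rewrite !mem_enum inE => /andP[].
have sP (A : {set V}) : A \in s -> A \subset Z0 /\ A != finset.set0.
  rewrite mem_cat !mem_enum => AP; have : A \in P.
    by case/orP: AP => [/(fintype.subsetP onesP)//|]; rewrite inE => /andP[].
  by rewrite !inE => /andP[].
(* [zp] serves as a parity bit. *)
pose ev (A : {set V}) := if odd #|A| then zp |: A else A.
have ev_trace (A : {set V}) : A \subset Z0 -> ev A :&: Z0 = A.
  move=> AZ0; apply/setP => u; rewrite inE /ev.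
  have uA : u \in A -> u \in Z0 by apply: (fintype.subsetP AZ0).
  case: ifP => _; last by case: (u \in A) uA => // ->.
  rewrite !inE; case: eqP => [->|_] /=.
    by rewrite (negPf zpZ0); apply/esym/negbTE; apply: contraNN zpZ0; apply: (fintype.subsetP AZ0).
  by case: (u \in A) uA => // ->.
pose vs := enum (~: Z).
have size_vs : size vs = #|V| - b.+1 by rewrite -cardE cardsCs finset.setCK cZ.
(* The default [set0] is never reached for outer vertices, by [idx]. *)
pose g v := ev (nth finset.set0 s (index v vs)).
have idx v : v \notin Z -> index v vs < size s.
  move=> vZ; apply: (@leq_trans (size vs)); last by rewrite size_vs size_s; lia.
  by rewrite index_mem mem_enum inE.
have gs v : v \notin Z -> nth finset.set0 s (index v vs) \in s.
  by move=> /idx; exact: mem_nth.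
have g_one z : z \in Z0 -> exists2 v, v \notin Z & g v = [set zp; z].
  move=> zZ0; pose i := index [set z] (enum ones).
  have ib : i < b by rewrite -size_ones index_mem mem_enum; apply: imset_f.
  have ivs : i < size vs by rewrite size_vs; lia.
  have nZ : nth zp vs i \notin Z.
    by have := mem_nth zp ivs; rewrite mem_enum inE.
  exists (nth zp vs i) => //.
  rewrite /g index_uniq ?enum_uniq // nth_cat size_ones ib nth_index.
    by rewrite /ev cards1.
  by rewrite mem_enum; apply: imset_f.
have V3 : 2 < #|V| by lia.
have Z2 : 1 < #|Z| by rewrite cZ; lia.
have gZ v : v \notin Z -> [/\ g v \subset Z, g v != finset.set0 & ~~ odd #|g v|].
  move=> vZ; have [sub ne] := sP _ (gs v vZ); rewrite /g /ev; move: sub ne.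
  move: (nth _ _ _) => A sub ne; case: ifP => oA; split=> //.
  - by rewrite finset.setUS.
  - by apply/set0Pn; exists zp; rewrite !inE eqxx.
  - rewrite cardsU1 oddD oA; suff -> : zp \notin A by [].
    by apply: contraNN zpZ0; apply: (fintype.subsetP sub).
  - exact: fintype.subset_trans sub (finset.subsetUr _ _).
  - by rewrite oA.
have g_inj : {in ~: Z &, injective g}.
  have trace v : v \notin Z -> g v :&: Z0 = nth finset.set0 s (index v vs).
    by move=> vZ; apply: ev_trace; have [] := sP _ (gs v vZ).
  move=> v w; rewrite !finset.in_setC => vZ wZ /(congr1 (fun A => A :&: Z0)).
  rewrite !trace // => /eqP; rewrite nth_uniq ?idx // => /eqP iE.
  by apply: (@index_inj _ zp vs v w _ _ iE); rewrite mem_enum finset.in_setC.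
have g_sep z t : z \in Z -> t \in Z -> z != t ->
    exists2 v, v \notin Z & (z \in g v) != (t \in g v).
  (* If [w] is [zp], a set [{zp, r}] with [r] in [Z0] other than [u] separates; otherwise [{zp, u}]
     does. *)
  have aux u w : u \in Z0 -> w \in Z -> u != w ->
      exists2 v, v \notin Z & (u \in g v) != (w \in g v).
    have zpN x : x \in Z0 -> x != zp by move=> xZ0; apply: contraNneq zpZ0 => <-.
    move=> uZ0; rewrite !inE => /orP[/eqP->|wZ0] uw.
      have /card_gt1P[x [y [xZ0 yZ0 xy]]] : 1 < #|Z0| by rewrite cZ0.
      have [r rZ0 ru] : exists2 r, r \in Z0 & u != r.
        by have [ux|] := eqVneq u x; [exists y; rewrite ?ux|exists x].
      have [v vZ gv] := g_one r rZ0; exists v; rewrite // gv.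
      by rewrite !inE eqxx (negPf ru) (negPf (zpN u uZ0)).
    have [v vZ gv] := g_one u uZ0; exists v; rewrite // gv.
    by rewrite !inE eqxx orbT (negPf (zpN w wZ0)) [w == u]eq_sym (negPf uw).
  move=> + tZ zt; rewrite in_setU1 => /orP[/eqP zE|zZ0]; last exact: aux.
  have tZ0 : t \in Z0 by move: tZ; rewrite in_setU1 -zE eq_sym (negPf zt).
  have [||v vZ sep] := aux t z tZ0; rewrite 1?eq_sym // ?zE ?setU11 //.
  by exists v; rewrite // eq_sym -zE.
exists (code_graph Z); split; last by rewrite -cZ; exact: code_graph_edges.
  exact: code_graph_2connected.
exact: code_graph_rc2 gZ g_inj g_sep.
Qed.

(** * Bounds on [t2 n 2] in terms of the integer logarithm *)

Lemma t2P n : 4 <= trunc_log 2 n ->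
  (exists G : sgraph 'I_n, [/\ k_connected 2 G, rc2 G <= 2 & #|edges G| = t2 n 2]) /\
  t2 n 2 <= n * (trunc_log 2 n + 2).
Proof.
set L := trunc_log 2 n => L4.
have n0 : 0 < n by rewrite lt0n; apply: contraTneq L4 => n0; rewrite /L n0 trunc_log0.
have /andP[Ln nL] : 2 ^ L <= n < 2 ^ L.+1 by apply: trunc_log_bounds.
(* True from [L = 4] on; it leaves enough outer vertices for [b = L + 1], for which [2 ^ b] exceeds
   [n]. *)
have L2 : L.+1.*2 < 2 ^ L.
  elim: (L) L4 => // l IH; rewrite leq_eqVlt => /orP[/eqP<- //|/IH].
  by rewrite (expnS 2 l); lia.
have [|||G [G2 Grc Gm]] := @sparse_graph 'I_n L.+1; rewrite ?card_ord; [lia..|].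
pose P := [set m | exists G : sgraph 'I_n,
    [/\ k_connected 2 G, rc2 G <= 2 & #|edges G| = m]]%classic.
have [] : P (t2 n 2) /\ t2 n 2 <= #|edges G| by apply: leastP; exists G.
move=> Pt tm; split=> //; apply: leq_trans tm _.
by move: Gm; rewrite card_ord addn2.
Qed.

(* [2 ^ loss L >= (D * D + 1) * (L + 2)] for the degree threshold
   [D = 2 * (L + 2) ^ 2]. *)
Definition loss L := 3 + 5 * up_log 2 (L + 2).

(** Take [k = L - loss L] in an extremal graph. Both exceptional terms, [h] and [X], are at most
    [n / (L + 2)], so they cost at most [2 * n] edges. *)
Lemma t2_lower n : 4 <= trunc_log 2 n ->
  n * trunc_log 2 n <= t2 n 2 + n * (loss (trunc_log 2 n) + 2).
Proof.
move=> L4; have [[G [G2 Grc Gm]] up] := t2P L4; move: L4 up.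
set L := trunc_log 2 n => L4 up; set m := t2 n 2 in Gm up *.
have n0 : 0 < n by rewrite lt0n; apply: contraTneq L4 => n0; rewrite /L n0 trunc_log0.
have Ln : 2 ^ L <= n by apply: trunc_logP.
have [c [col rb]] := rc2_attained G2.
have col2 : is_colouring G 2 c by move=> e /col /leq_trans; apply.
have [cL|cL] := leqP (loss L) L; last first.
  by apply: leq_trans (leq_addl _ _); rewrite leq_mul2l (leq_trans (ltnW cL)) ?orbT ?leq_addr.
set k := L - loss L; set D := 2 * (L + 2) ^ 2.
have [h] := edges_lower_bound D k (rainbow_links col2 rb).
rewrite Gm card_ord => -[hD]; set X := 2 ^ k * _ => km.
(* The upper bound on [m] enters here: [h * D <= 2 * m <= 2 * n * (L + 2)]. *)
have hn : h * (L + 2) <= n.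
  have : h * (L + 2) * (2 * (L + 2)) <= n * (2 * (L + 2)).
    by move: hD; rewrite /D expnS expn1; lia.
  by rewrite leq_pmul2r // muln_gt0 addn_gt0 orbT.
have Xn : X * (L + 2) <= n.
  apply: leq_trans Ln; rewrite -[in leqRHS](subnK cL) -/k expnD /X -mulnA leq_mul2l.
  (* Of the five factors [L + 2], four come from [D * D]; the constants are absorbed by [2 ^ 3]. *)
  rewrite /loss expnD (mulnC 5) expnM.
  have : (L + 2) ^ 5 <= (2 ^ up_log 2 (L + 2)) ^ 5 by rewrite leq_exp2r ?up_logP.
  move=> le; apply/orP; right; apply: leq_trans (leq_mul (leqnn _) le).
  rewrite /D (expnS _ 4) [_ ^ 4](expnM _ 2 2) -!mulnn.
  have arith a q : 0 < q -> (2 * q * (2 * q) + 1) * a <= 2 ^ 3 * (a * (q * q)).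
    move=> q0; have : a <= a * (q * q) by rewrite leq_pmulr // muln_gt0 q0.
    lia.
  by apply: arith; rewrite muln_gt0 addn_gt0 orbT.
have kL : k <= L + 2 by rewrite /k; lia.
have nk : n * L = n * loss L + k * n by rewrite (mulnC k) -mulnDr subnKC.
move: X km Xn => X km Xn.
have k1 : k * n <= k * (n - h - X) + k * (h + X).
  by rewrite -mulnDr leq_mul2l; apply/orP; right; lia.
have k2 : k * (h + X) <= n * 2.
  by apply: (@leq_trans ((L + 2) * (h + X))); [rewrite leq_mul2r kL orbT|lia].
lia.
Qed.

Lemma loss_sublinear K : exists L0, forall L, L0 <= L -> K * (loss L + 3) <= L.
Proof.
(* With [u * u <= 4 * (L + 2)], the inequality of means for [20 * K] and [u] bounds
   [6 * K + 5 * K * u] by [6 * K + 50 * K ^ 2 + L / 2 + 1], which is at most [L] from here on. *)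
exists (12 * K + 100 * (K * K) + 2) => L LL0; rewrite /loss; set u := up_log _ _.
have sq : u * u <= 4 * (L + 2).
  have /andP[+ _] : 2 ^ u.-1 < L + 2 <= 2 ^ u by apply: up_log_bounds => //; lia.
  have : u * u <= 4 * 2 ^ u.-1.
    elim: (u) => // -[|[|[|i]]] //; rewrite !succnK (expnS 2 i.+2); nia.
  lia.
have [+ _] := nat_Cauchy (20 * K) u; rewrite -!mulnn.
move: u sq => u sq am; lia.
Qed.

(** * Real logarithms and the limit *)

Local Open Scope classical_set_scope.
Local Open Scope ring_scope.

Lemma trunc_log_log2 (R : realType) n : (0 < n)%N ->
  (trunc_log 2 n)%:R <= log2 (n%:R : R) <= (trunc_log 2 n).+1%:R.
Proof.
move=> n0; have ln2 : 0 < ln (2 : R) by rewrite ln_gt0 // ltr1n.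
have /andP[lo hi] : (2 ^ trunc_log 2 n <= n < 2 ^ (trunc_log 2 n).+1)%N.
  exact: trunc_log_bounds.
have lnX k : k%:R * ln 2 = ln ((2 ^ k)%N%:R : R).
  by rewrite natrX lnXn // mulr_natl.
rewrite /log2 ler_pdivlMr // ler_pdivrMr // !lnX.
by rewrite !ler_ln ?posrE ?ltr0n ?expn_gt0 // !ler_nat lo ltnW.
Qed.

Lemma t2_asymptotics (R : realType) (K : nat) :
  exists n0, forall n, (n0 <= n)%N ->
    K%:R * `|(t2 n 2)%:R - n%:R * log2 (n%:R : R)| <= n%:R * log2 (n%:R : R).
Proof.
have [L0 lossK] := loss_sublinear K.
exists (2 ^ (L0 + 4))%N => n n0.
have n1 : (0 < n)%N by apply: leq_trans n0; rewrite expn_gt0.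
have LB : (L0 + 4 <= trunc_log 2 n)%N by exact: trunc_log_max.
have L4 : (4 <= trunc_log 2 n)%N by lia.
have [_ up] := t2P L4; have low := t2_lower L4; have {}lossK := lossK (trunc_log 2 n).
have /andP[lo hi] := trunc_log_log2 R n1.
move: LB L4 up low lossK lo hi; set L := trunc_log 2 n; set l := log2 _ => LB L4 up low lossK lo hi.
set m := t2 n 2 in up low *.
have {}up : (m%:R : R) <= n%:R * (L%:R + 2) by rewrite -natrD -natrM ler_nat.
have {}low : (n%:R : R) * L%:R <= m%:R + n%:R * ((loss L)%:R + 2).
  by rewrite -!natrD -!natrM -natrD ler_nat.
have {}lossK : (K%:R : R) * ((loss L)%:R + 3) <= L%:R.
  by rewrite -natrD -natrM ler_nat; apply: lossK; lia.
have K0 : 0 <= (K%:R : R) by [].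
have N0 : 0 <= (n%:R : R) by [].
rewrite -natr1 in hi.
have nlo : (n%:R : R) * L%:R <= n%:R * l by rewrite ler_wpM2l.
have nhi : (n%:R : R) * l <= n%:R * (L%:R + 1) by rewrite ler_wpM2l.
have nloss : 0 <= (n%:R : R) * (loss L)%:R by rewrite mulr_ge0.
(* The lower bound loses [loss L + 2] per vertex, and rounding the logarithm one more. *)
have err : `|m%:R - n%:R * l| <= n%:R * ((loss L)%:R + 3).
  by rewrite ler_norml; apply/andP; split; lra.
apply: le_trans (ler_wpM2l K0 err) _; apply: le_trans nlo.
by rewrite mulrCA ler_wpM2l.
Qed.

Theorem theorem3p1 (R : realType) :
  exists eps : nat -> R,
    eps n @[n --> \oo] --> (0 : R) /\
    \forall n \near \oo,
      (t2 n 2)%:R = (1 + eps n) * (n%:R * log2 (n%:R : R)).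
Proof.
pose f n : R := n%:R * log2 (n%:R : R).
have f_gt0 n : (1 < n)%N -> 0 < f n.
  move=> n1; rewrite mulr_gt0 ?ltr0n ?(ltnW n1) //.
  have /andP[+ _] := trunc_log_log2 R (ltnW n1); apply: lt_le_trans.
  by rewrite ltr0n; apply: (@trunc_log_max 2%N n 1%N).
(* The relative error; [f n] is positive only from [n = 2] on. *)
exists (fun n => (t2 n 2)%:R / f n - 1); split; last first.
  exists 2%N => // n /= n1; rewrite addrC subrK divfK //.
  by rewrite gt_eqF // f_gt0.
apply/cvgr0Pnorm_le => e e0.
(* An integer above [1 / e], so that relative error [1 / K] is below [e]. *)
pose K := (Num.truncn e^-1).+1.
have Ke : 1 <= K%:R * e.
  by rewrite -ler_pdivrMr // div1r ltW // truncnS_gt.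
have [n0 n0P] := t2_asymptotics R K.
exists (n0 + 2)%N => // n /= n_ge.
have fn : 0 < f n by apply: f_gt0; lia.
have -> : (t2 n 2)%:R / f n - 1 = ((t2 n 2)%:R - f n) / f n.
  by rewrite mulrBl divff // gt_eqF.
rewrite normrM normfV (gtr0_norm fn) ler_pdivrMr //.
have {n0P} := n0P n _; rewrite -/(f n) => /(_ ltac:(lia)) le.
rewrite -(@ler_pM2l _ K%:R) ?ltr0n //; apply: le_trans le _.
by rewrite mulrA ler_peMl // ltW.
Qed.
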